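(* Let $k$ be a perfect field, and let $R$ be the affine coordinate ring of an elliptic curve over $k$. Then $R$ is a unit-additive integral domain whose field of units is $k$.
   Context: All rings are commutative and unital. A ring $R$ is unit-additive if whenever $u,v$ are units of $R$, $u+v$ is either a unit of $R$ or a nilpotent element. For a reduced unit-additive ring $R$, the set $U(R)\cup\{0\}$ ($U(R)$ the group of units) is a field, called the field of units of $R$. The affine coordinate ring of an elliptic curve over $k$ is (up to isomorphism) the ring $k[X,Y]/(f)$ where $f=Y^2+c(X)Y+p(X)$ is a Weierstrass equation of the affine part of the curve, with $c\in k\oplus kX$ and $-p\in k[X]$ a monic cubic. *)

(* Defs.v *)
From HB Require Import structures.
From mathcomp Require Import all_boot all_order all_algebra all_field.

Set Implicit Arguments.
Unset Strict Implicit.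
Unset Printing Implicit Defensive.

Import GRing.Theory.
Local Open Scope ring_scope.

(* Rings are [comPzRingType]s, so that 1 != 0 is not built in.  Being a unit
   is spelled out because [GRing.unit] requires a [unitRingType], i.e. an
   inverse operation given together with the ring. *)
Definition is_unit (R : comPzRingType) (u : R) : Prop := exists v : R, u * v = 1.

Definition is_nilpotent (R : comPzRingType) (x : R) : Prop :=
  exists n : nat, x ^+ n = 0.

Definition unit_additive (R : comPzRingType) : Prop :=
  forall u v : R, is_unit u -> is_unit v ->
    is_unit (u + v) \/ is_nilpotent (u + v).

Definition is_domain (R : comPzRingType) : Prop :=
  (1 : R) != 0 /\ GRing.integral_domain_axiom R.

Definition in_field_of_units (R : comPzRingType) (x : R) : Prop :=
  is_unit x \/ x = 0.

(* The structure map iota identifies k with U(R) together with 0. *)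
Definition field_of_units_is (k : fieldType) (R : comPzRingType)
    (iota : {rmorphism k -> R}) : Prop :=
  injective iota /\
  forall x : R, in_field_of_units x <-> exists a : k, iota a = x.

Definition perfect_field (k : fieldType) : Prop :=
  forall q : {poly k}, irreducible_poly q -> separable_poly q.

(* k[X,Y] is {poly {poly k}}: the inner variable is X and the outer one is Y,
   which is the opposite of the naming in polyXY. *)
Definition weierstrass (k : fieldType) (c p : {poly k}) : {poly {poly k}} :=
  'X^2 + c *: 'X + p%:P.

Definition eval_XY (K : fieldType) (g : {poly {poly K}}) (x y : K) : K :=
  g.[y%:P].[x].

Definition deriv_X (K : fieldType) (g : {poly {poly K}}) : {poly {poly K}} :=
  map_poly (fun q : {poly K} => q^`()) g.

Definition deriv_Y (K : fieldType) (g : {poly {poly K}}) : {poly {poly K}} :=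
  g^`().

(* No singular point with coordinates in any field extension K of k, in
   particular none over an algebraic closure.  The point at infinity of a
   Weierstrass curve is always nonsingular. *)
Definition smooth_affine_curve (k : fieldType) (f : {poly {poly k}}) : Prop :=
  forall (K : fieldType) (sigma : {rmorphism k -> K}) (x y : K),
    let fK := map_poly (map_poly sigma) f in
    eval_XY fK x y = 0 ->
    ~ (eval_XY (deriv_X fK) x y = 0 /\ eval_XY (deriv_Y fK) x y = 0).

Definition elliptic_weierstrass (k : fieldType) (c p : {poly k}) : Prop :=
  [/\ (size c <= 2)%N, size (- p) = 4%N, - p \is monic
    & smooth_affine_curve (weierstrass c p)].

(* Since the Weierstrass polynomial is monic in Y, k[X,Y]/(f) is the
   quotient of k[X][Y] by a monic polynomial; see [in_weierstrass_quotient_eq0]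
   for the kernel of the projection. *)
Definition weierstrass_quotient (k : fieldType) (c p : {poly k}) : comNzRingType :=
  {poly %/ weierstrass c p}.

Definition weierstrass_const (k : fieldType) (c p : {poly k}) (a : k) :
    weierstrass_quotient c p :=
  in_qpoly (weierstrass c p) a%:P%:P.

(* (R, iota) is isomorphic, as a k-algebra, to k[X,Y]/(f) for the Weierstrass
   equation f of some elliptic curve over k. *)
Definition elliptic_coordinate_ring (k : fieldType) (R : comPzRingType)
    (iota : {rmorphism k -> R}) : Prop :=
  exists c p : {poly k}, elliptic_weierstrass c p /\
    exists phi : {rmorphism weierstrass_quotient c p -> R},
      bijective phi /\ forall a : k, phi (weierstrass_const c p a) = iota a.

Lemma size_weierstrass (k : fieldType) (c p : {poly k}) :
  size (weierstrass c p) = 3%N.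
Proof.
rewrite /weierstrass -addrA size_polyDl size_polyXn //.
rewrite (leq_ltn_trans (size_polyD _ _)) // gtn_max.
rewrite (leq_ltn_trans (size_scale_leq _ _)) ?size_polyX //=.
by rewrite (leq_ltn_trans (size_polyC_leq1 _)).
Qed.

Lemma monic_weierstrass (k : fieldType) (c p : {poly k}) :
  weierstrass c p \is monic.
Proof.
rewrite monicE /lead_coef size_weierstrass /weierstrass.
by rewrite !coefD coefXn coefZ coefX coefC /= mulr0 !addr0.
Qed.

Lemma mk_monic_weierstrass (k : fieldType) (c p : {poly k}) :
  mk_monic (weierstrass c p) = weierstrass c p.
Proof. by rewrite /mk_monic size_weierstrass monic_weierstrass. Qed.

Lemma in_weierstrass_quotient_eq0 (k : fieldType) (c p : {poly k})
    (g : {poly {poly k}}) :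
  in_qpoly (weierstrass c p) g = 0 <-> exists h, g = h * weierstrass c p.
Proof.
have f_monic := monic_weierstrass c p.
split=> [/(congr1 val) /= | [h ->]].
  rewrite mk_monic_weierstrass => r0.
  exists (Pdiv.CommonRing.rdivp g (weierstrass c p)).
  by rewrite {1}(Pdiv.RingMonic.rdivp_eq f_monic g) r0 addr0.
apply/val_inj; rewrite /= mk_monic_weierstrass.
exact: Pdiv.RingMonic.rmodp_mull.
Qed.

(* Main.v *)
(** A residue class modulo the Weierstrass polynomial is uniquely [a + bY] with
    [a, b] in [k[X]].  Its norm [a^2 - abc + b^2 p] down to [k[X]] is
    multiplicative, and it has degree [max (2 deg a, 2 deg b + 3)]: the parities
    differ, so the leading terms cannot cancel, and the cross term is too small
    because [deg c <= 1].  Hence only [0] has norm [0], and only constants have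
    constant norm.  The units are therefore the nonzero constants. *)
Require Import Defs.
From mathcomp Require Import all_boot all_order all_algebra all_field.
From mathcomp Require Import ring zify.

Set Implicit Arguments.
Unset Strict Implicit.
Unset Printing Implicit Defensive.

Import GRing.Theory.
Local Open Scope ring_scope.

(** The product of [a + bY] with its conjugate [a - bc - bY], obtained from the involution
    [Y -> -c - Y] of the curve. *)
Definition wnorm (k : fieldType) (c p a b : {poly k}) : {poly k} :=
  a ^+ 2 - a * b * c + b ^+ 2 * p.

Lemma wnorm_size_le1 (k : fieldType) (c p a b : {poly k}) :
  (size c <= 2)%N -> size p = 4%N -> (size (wnorm c p a b) <= 1)%N ->
  b = 0 /\ (size a <= 1)%N.
Proof.
move=> c2 p4.
(* The truncated predecessor makes this formula valid for [q = 0] as well. *)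
have sq (q : {poly k}) : size (q ^+ 2) = (size q * 2).-1%N.
  have [->|q0] := eqVneq q 0; first by rewrite expr0n size_poly0.
  by rewrite expr2 size_mul // muln2 addnn.
have [-> | b0] := eqVneq b 0.
  by rewrite /wnorm mulr0 mul0r subr0 expr0n mul0r addr0 sq; split=> //; lia.
have p0 : p != 0 by rewrite -size_poly_gt0 p4.
have b1 : (0 < size b)%N by rewrite size_poly_gt0.
have sb : size (b ^+ 2 * p) = (size b * 2 + 2)%N.
  by rewrite size_mul ?expf_neq0 // sq p4; lia.
have sabc : (size (- (a * b * c))%R <= size a + size b)%N.
  rewrite size_polyN (leq_trans (size_polyMleq _ _)) //.
  move: c2 b1 (size_polyMleq a b); move: (size (a * b)) (size a) (size b) (size c); lia.
(* If [size a <= size b + 1], then [b ^+ 2 * p] is strictly longer than the other two terms;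
   otherwise [a ^+ 2] is. Either way the norm has size above 1. *)
rewrite /wnorm; case: (leqP (size a) (size b).+1) => ab.
  rewrite addrC size_polyDl ?sb; first by move=> s1; exfalso; lia.
  rewrite (leq_ltn_trans (size_polyD _ _)) // gtn_max sq (leq_ltn_trans sabc); lia.
rewrite -addrA size_polyDl sq; first by move=> s1; exfalso; lia.
rewrite (leq_ltn_trans (size_polyD _ _)) // gtn_max sb (leq_ltn_trans sabc); lia.
Qed.

(** The arguments on the left are the coordinates of [(a + bY)(a' + b'Y)] after [Y^2] is replaced by
    [-cY - p]. *)
Lemma wnormM (k : fieldType) (c p a b a' b' : {poly k}) :
  wnorm c p (a * a' - b * b' * p) (a * b' + b * a' - b * b' * c) =
  wnorm c p a b * wnorm c p a' b'.
Proof. rewrite /wnorm; ring. Qed.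

Section Quotient.
Variables (k : fieldType) (c p : {poly k}).

Definition welt (a b : {poly k}) : weierstrass_quotient c p :=
  in_qpoly (weierstrass c p) (a%:P + b%:P * 'X).

Lemma val_welt a b : val (welt a b) = a%:P + b%:P * 'X.
Proof.
apply: in_qpoly_small; rewrite mk_monic_weierstrass size_weierstrass.
rewrite addrC -cons_poly_def size_cons_poly; case: ifP => // _.
by rewrite !ltnS size_polyC_leq1.
Qed.

Lemma welt_inj a b a' b' : welt a b = welt a' b' -> a = a' /\ b = b'.
Proof.
move=> /(congr1 val); rewrite !val_welt => e.
split; [have := congr1 (coefp 0) e | have := congr1 (coefp 1) e];
  by rewrite /= !coefD !coefC !coefMX !coefC /= ?addr0 ?add0r.
Qed.

Lemma welt_surj (x : weierstrass_quotient c p) : exists a b, x = welt a b.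
Proof.
have sx : (size (val x) <= 2)%N.
  by have := size_mk_monic x; rewrite {2}mk_monic_weierstrass size_weierstrass.
exists (val x)`_0, (val x)`_1; apply: val_inj; rewrite val_welt.
apply/polyP=> i; rewrite coefD coefC coefMX coefC.
case: i => [|[|i]] /=; rewrite ?addr0 ?add0r //.
by rewrite nth_default // (leq_trans sx).
Qed.

Lemma weltM a b a' b' :
  welt a b * welt a' b' =
  welt (a * a' - b * b' * p) (a * b' + b * a' - b * b' * c).
Proof.
(* Adding [b * b'] times the Weierstrass polynomial to the reduced representative recovers the
   unreduced product. *)
have f0 : in_qpoly (weierstrass c p) ((b * b')%:P * weierstrass c p) = 0.
  by apply/in_weierstrass_quotient_eq0; exists (b * b')%:P.
rewrite /welt -in_qpolyM -[RHS]addr0 -f0 -in_qpolyD.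
congr in_qpoly; rewrite /weierstrass -mul_polyC !(polyCD, polyCM, polyCN); ring.
Qed.

Lemma welt_const a : weierstrass_const c p a = welt a%:P 0.
Proof. by rewrite /welt mul0r addr0. Qed.

Lemma welt0 : welt 0 0 = 0.
Proof. by rewrite /welt mul0r addr0 in_qpoly0. Qed.

Lemma welt1 : welt 1 0 = 1.
Proof. by rewrite /welt mul0r addr0 in_qpoly1. Qed.

Hypotheses (c2 : (size c <= 2)%N) (p4 : size p = 4%N).

Lemma welt_norm_eq0 a b : wnorm c p a b = 0 -> welt a b = 0.
Proof.
move=> n0; have [|b0 a1] := @wnorm_size_le1 _ c p a b c2 p4.
  by rewrite n0 size_poly0.
move: n0; rewrite /wnorm b0 mulr0 mul0r subr0 expr0n mul0r addr0 => /eqP.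
by rewrite expf_eq0 => /eqP ->; rewrite welt0.
Qed.

(** The two norms multiply to 0 in the domain [k[X]], so one of them vanishes. *)
Lemma weierstrass_quotient_integral (x y : weierstrass_quotient c p) :
  x * y = 0 -> x = 0 \/ y = 0.
Proof.
have [a [b ->]] := welt_surj x; have [a' [b' ->]] := welt_surj y.
rewrite weltM -welt0 => /welt_inj [e1 e2].
have := wnormM c p a b a' b'; rewrite e1 e2 welt0.
rewrite {1}/wnorm mul0r mul0r subr0 expr0n mul0r addr0 => /esym/eqP.
by rewrite mulf_eq0 => /orP [] /eqP /welt_norm_eq0; [left | right].
Qed.

Lemma weierstrass_quotient_unit (x y : weierstrass_quotient c p) :
  x * y = 1 -> exists a, x = weierstrass_const c p a.
Proof.
have [a [b ->]] := welt_surj x; have [a' [b' ->]] := welt_surj y.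
rewrite weltM -welt1 => /welt_inj [e1 e2].
have := wnormM c p a b a' b'; rewrite e1 e2.
rewrite {1}/wnorm mulr0 mul0r subr0 expr1n expr0n mul0r addr0 => /esym n1.
(* The norms multiply to 1 in [k[X]], so each is a nonzero constant. *)
have /esym := size_mul_eq1 (wnorm c p a b) (wnorm c p a' b').
rewrite n1 size_poly1 => /andP [/eqP s1 _].
have [|b0 a1] := @wnorm_size_le1 _ c p a b c2 p4; first by rewrite s1.
by exists a`_0; rewrite welt_const b0 -size1_polyC.
Qed.

End Quotient.

Theorem corollary5p5 (k : fieldType) (R : comPzRingType)
    (iota : {rmorphism k -> R}) :
  perfect_field k ->
  elliptic_coordinate_ring iota ->
  unit_additive R /\ is_domain R /\ field_of_units_is iota.
Proof.
move=> _ [c [p [[c2 sp _ _] [phi [[psi phiK psiK] phi_const]]]]].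
have p4 : size p = 4%N by rewrite -sp size_polyN.
have unit_iota a : a != 0 -> is_unit (iota a).
  by move=> a0; exists (iota a^-1); rewrite -rmorphM mulfV // rmorph1.
have iota_unit u : is_unit u -> exists a, iota a = u.
  case=> v uv; have [|a ua] :=
    @weierstrass_quotient_unit k c p c2 p4 (psi u) (psi v).
    (* [psi] is only known as a two-sided inverse map, so the equation is checked after applying the
       injective morphism [phi]. *)
    by apply: (can_inj phiK); rewrite rmorphM !psiK uv rmorph1.
  by exists a; rewrite -phi_const -ua psiK.
have iota_field a : is_unit (iota a) \/ iota a = 0.
  by have [->|/unit_iota] := eqVneq a 0; [right; rewrite rmorph0 | left].
have R1 : (1 : R) != 0.
  apply/eqP=> e; have /eqP := oner_neq0 (weierstrass_quotient c p); apply.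
  by apply: (can_inj phiK); rewrite rmorph1 rmorph0.
split; last split.
(* Both units are constants, so their sum is a constant: either a unit or 0, which is nilpotent with
   exponent 1. *)
- move=> u v /iota_unit [a <-] /iota_unit [b <-]; rewrite -rmorphD.
  by have [|->] := iota_field (a + b); [left | right; exists 1%N; rewrite expr1].
- split=> // x y xy0.
  have [|/(congr1 phi)|/(congr1 phi)] :=
    @weierstrass_quotient_integral k c p c2 p4 (psi x) (psi y).
  + by apply: (can_inj phiK); rewrite rmorphM !psiK xy0 rmorph0.
  + by rewrite psiK rmorph0 => ->; rewrite eqxx.
  + by rewrite psiK rmorph0 => ->; rewrite eqxx orbT.
split.
  move=> a b; rewrite -!phi_const !welt_const => /(can_inj phiK).
  by move=> /welt_inj [] /polyC_inj.
move=> x; split=> [[/iota_unit // | ->] | [a <-]]; last exact: iota_field.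
by exists 0; rewrite rmorph0.
Qed.
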